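(* For any (oriented) virtual knot $K$, $$W_K(t) = -\Delta'_0(K)(t, t^{-1}),$$ where $W_K(t)$ is the writhe polynomial of $K$ and $\Delta'_0(K)(u,v)$ is the Laurent polynomial determined by $\Delta_0(K)(u,v) = (1-uv)\,\Delta'_0(K)(u,v)$, with $\Delta_0(K)$ the normalized Alexander polynomial of $K$.
   Context: Virtual knots are equivalence classes of oriented virtual knot diagrams (with classical and virtual crossings) modulo the classical and virtual Reidemeister moves; equivalently, equivalence classes of Gauss diagrams modulo the moves induced by the classical Reidemeister moves. The Gauss diagram of $D$ is an oriented circle with one chord per classical crossing $c$, directed from the over-crossing point to the under-crossing point and labelled with the crossing sign $\varepsilon(c)=\pm1$. The over-crossing endpoint of $c$ is labelled with the sign $-\varepsilon(c)$ and the under-crossing endpoint with $\varepsilon(c)$. For a chord $c$ from $P$ (over) to $Q$ (under), let $\alpha$ be the open arc of the circle from $P$ to $Q$ following the orientation. The index $Ind(c)$ is the sum of the signs of all chord endpoints on $\alpha$. Writhe polynomial: $Wr(D)=\sum_c \varepsilon(c)$; for $n\in\mathbb{Z}$, $w_n(D)=\sum_{Ind(c)=n}\varepsilon(c)$. For $K$ with diagram $D$, $w_n(K)=w_n(D)$ for $n\ne 0$ and $w_0(K)=w_0(D)-Wr(D)$ (these are invariants of $K$), and $W_K(t)=\sum_{n\in\mathbb{Z}} w_n(K)t^n$. Alexander polynomial: let $D$ have $n\ge 1$ classical crossings $c_1,\dots,c_n$. An arc of $D$ runs from one classical crossing passage to the next one (virtual crossings are ignored), so there are $2n$ arcs $a_1,\dots,a_{2n}$,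 labelled so that the arcs coming into $c_i$ are $a_{2i-1}$ and $a_{2i}$: if $c_i$ is positive, $a_{2i-1}$ is the incoming under-strand and $a_{2i}$ the incoming over-strand; if $c_i$ is negative, $a_{2i-1}$ is the incoming over-strand and $a_{2i}$ the incoming under-strand. Let $M$ be the $2n\times 2n$ block diagonal matrix with blocks $M_1,\dots,M_n$, where $M_i=\begin{pmatrix} u^{-1} & 1-(uv)^{-1}\\ 0& v^{-1}\end{pmatrix}$ if $c_i$ is positive and $M_i=\begin{pmatrix} v&0\\ 1-uv& u\end{pmatrix}$ if $c_i$ is negative. Let $\pi$ be the $2n$-cycle on arcs sending each arc to the next arc along the oriented knot, and let $P$ be the matrix with $P_{ij}=1$ if $\pi(a_i)=a_j$ and $0$ otherwise. Set $\Delta_0(D)(u,v)=\det(M-P)$. (For a diagram without classical crossings, $\Delta_0(D)=0$.) This is well defined for $K$ up to multiplication by powers of $uv$; the normalized polynomial $\Delta_0(K)$ is $(uv)^{-k}\Delta_0(D)$, where $k$ is the minimum among all powers of $u$ in $\Delta_0(D)$ (and $\Delta_0(K)=0$ if $\Delta_0(D)=0$). It is known that $(1-u)(1-v)(1-uv)$ divides $\Delta_0(K)(u,v)$ in $\mathbb{Z}[u^{\pm1},v^{\pm1}]$. *)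

(* Defs.v *)
From HB Require Import structures.
From mathcomp Require Import all_boot all_order all_fingroup all_algebra.
From mathcomp Require Import finmap monalg.

Set Implicit Arguments.
Unset Strict Implicit.
Unset Printing Implicit Defensive.

Import Order.TTheory GRing.Theory Num.Theory.
Local Open Scope ring_scope.

(* The integral group ring Z[K] of an additive group K.  The carrier
   {malg int[K]} (finitely supported functions K -> int) is monalg's, but
   monalg only equips it with a product when K is a monoid without nontrivial
   units, which excludes Laurent exponents; hence the alias. *)
Definition group_ring (K : zmodType) : Type := {malg int[K]}.
HB.instance Definition _ (K : zmodType) := 
  GRing.Zmodule.copy (group_ring K) {malg int[K]}.

Definition gmono (K : zmodType) (k : K) : group_ring K := << k >>.

Section GroupRing.
Variable K : zmodType.
Implicit Types (g : {malg int[K]}) (k l : K).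

Local Notation "g1 *M_[ k1 , k2 ] g2" :=
  << g1@_k1%R * g2@_k2%R *g (k1 + k2)%R >>
  (at level 40, no associativity).

Definition gmul g1 g2 : {malg int[K]} :=
  \sum_(k1 <- msupp g1) \sum_(k2 <- msupp g2) g1 *M_[k1, k2] g2.

Lemma gmullw (d1 d2 : {fset K}) g1 g2 :
  (msupp g1 `<=` d1)%fset -> (msupp g2 `<=` d2)%fset ->
  gmul g1 g2 = \sum_(k1 <- d1) \sum_(k2 <- d2) g1 *M_[k1, k2] g2.
Proof.
move=> le_d1 le_d2; rewrite /gmul (big_fset_incl _ le_d1) /=.
  apply/eq_bigr=> k1 _; apply/big_fset_incl => // k _ /mcoeff_outdom ->.
  by rewrite mulr0 monalgU0.
move=> k _ /mcoeff_outdom g1k.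
by rewrite big1 => // k' _; rewrite g1k mul0r monalgU0.
Qed.

Lemma gmulC : commutative gmul.
Proof.
move=> g1 g2; rewrite /gmul exchange_big; apply/eq_bigr=> k1 _.
by apply/eq_bigr=> k2 _; rewrite mulrC addrC.
Qed.

Lemma gmul0g : left_zero 0 gmul.
Proof. by move=> g; rewrite /gmul msupp0 big_seq_fset0. Qed.

Lemma gmulUg c k g :
  gmul << c *g k >> g = \sum_(k' <- msupp g) << c * g@_k' *g (k + k')%R >>.
Proof.
rewrite (gmullw msuppU_le (fsubset_refl _)) big_seq_fset1.
by apply/eq_bigr => k' _; rewrite mcoeffUU.
Qed.

Lemma gmulUU c1 c2 k1 k2 :
  gmul << c1 *g k1 >> << c2 *g k2 >> = << c1 * c2 *g (k1 + k2)%R >>.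
Proof. by rewrite (gmullw msuppU_le msuppU_le) !big_seq_fset1 !mcoeffUU. Qed.

Lemma gmul1g : left_id << 0%R >> gmul.
Proof.
move=> g; rewrite gmulUg [RHS]monalgE.
by apply/eq_bigr=> kg _; rewrite mul1r add0r.
Qed.

Lemma gmulDl : left_distributive gmul +%R.
Proof.
move=> g1 g2 g.
rewrite [in RHS](gmullw (fsubsetUl (msupp g1) (msupp g2)) (fsubset_refl _)).
rewrite [in RHS](gmullw (fsubsetUr (msupp g1) (msupp g2)) (fsubset_refl _)).
rewrite (gmullw (msuppD_le _ _) (fsubset_refl _)).
rewrite -big_split /=; apply/eq_bigr=> k1 _.
rewrite -big_split /=; apply/eq_bigr=> k2 _.
by rewrite mcoeffD mulrDl monalgUD.
Qed.

Lemma gmul_suml (I : Type) (r : seq I) (F : I -> {malg int[K]}) g :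
  gmul (\sum_(i <- r) F i) g = \sum_(i <- r) gmul (F i) g.
Proof.
exact: (big_morph (gmul^~ g) (fun _ _ => gmulDl _ _ _) (gmul0g _)).
Qed.

Lemma gmul_sumr (I : Type) (r : seq I) (F : I -> {malg int[K]}) g :
  gmul g (\sum_(i <- r) F i) = \sum_(i <- r) gmul g (F i).
Proof. by rewrite gmulC gmul_suml; apply/eq_bigr=> i _; rewrite gmulC. Qed.

Lemma gmulA : associative gmul.
Proof.
move=> g1 g2 g3; rewrite (monalgE g1) (monalgE g2) (monalgE g3).
rewrite !gmul_suml; apply/eq_bigr=> k1 _.
rewrite gmul_sumr (gmul_sumr (msupp g2)) gmul_suml; apply/eq_bigr=> k2 _.
rewrite !gmul_sumr; apply/eq_bigr=> k3 _.
by rewrite !gmulUU mulrA addrA.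
Qed.

Lemma gone_neq0 : << 0%R >> != 0 :> {malg int[K]}.
Proof. by apply/eqP/malgP=> /(_ 0) /eqP; rewrite mcoeffUU mcoeff0. Qed.

HB.instance Definition _ := GRing.Zmodule_isComNzRing.Build (group_ring K)
  gmulA gmulC gmul1g gmulDl gone_neq0.

Lemma gmonoD k l : gmono (k + l) = gmono k * gmono l.
Proof. by rewrite [RHS]gmulUU mul1r. Qed.

Lemma gmono0 : gmono 0 = 1 :> group_ring K.
Proof. by []. Qed.

End GroupRing.

(* Z[t^{+-1}] and Z[u^{+-1}, v^{+-1}] *)
Notation laurent1 := (group_ring int).
Notation laurent2 := (group_ring (int * int)%type).

Definition tpow (i : int) : laurent1 := gmono i.
Definition uvpow (i j : int) : laurent2 := gmono (i, j).

(* f(t, t^-1) *)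
Definition eval_t_tinv (f : laurent2) : laurent1 :=
  mmap intr (fun e : int * int => tpow e.1 * tpow (- e.2)) f.

(* A Gauss diagram with chord set 'I_n.  The endpoints are listed in the cyclic
   order given by the orientation of the circle; (c, true) and (c, false) are
   the over- and under-crossing endpoints of c. *)
Record gauss (n : nat) := Gauss {
  endpoints : seq ('I_n * bool);
  positive : 'I_n -> bool;
  endpointsP : perm_eq endpoints (enum {: 'I_n * bool})
}.

Section Invariants.
Variables (n : nat) (D : gauss n).

Definition crossing_sign (c : 'I_n) : int := if positive D c then 1 else -1.

Definition endpoint_sign (p : 'I_n * bool) : int :=
  if p.2 then - crossing_sign p.1 else crossing_sign p.1.

(* [arc s x y] starts with x, which is removed to get the open arc. *)
Definition chord_index (c : 'I_n) : int :=
  \sum_(p <- behead (arc (endpoints D) (c, true) (c, false))) endpoint_sign p.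

Definition writhe : int := \sum_c crossing_sign c.

Definition diagram_writhe (k : int) : int :=
  \sum_(c | chord_index c == k) crossing_sign c.

Definition knot_writhe (k : int) : int :=
  if k == 0 then diagram_writhe 0 - writhe else diagram_writhe k.

(* The finite set only serves to make the support finite; see
   [writhe_polynomialE]. *)
Definition writhe_polynomial : laurent1 :=
  [malg k in [fset k | k in 0 :: [seq chord_index c | c <- enum 'I_n]]%fset
     => knot_writhe k].

Lemma writhe_polynomialE (k : int) :
  mcoeff k writhe_polynomial = knot_writhe k.
Proof.
rewrite mcoeffE in_fset /=; case: ifPn => //.
rewrite inE negb_or => /andP[k0 kN].
rewrite /knot_writhe (negbTE k0) /diagram_writhe big1 // => c /eqP ck.
by move: kN; rewrite -ck map_f // mem_enum.
Qed.

Lemma arc_crossing_subproof (j : 'I_n.*2) : (j./2 < n)%N.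
Proof. by rewrite ltn_half_double. Qed.

Definition arc_crossing (j : 'I_n.*2) : 'I_n :=
  Ordinal (arc_crossing_subproof j).

(* Every arc is identified with the endpoint at which it arrives; the arcs
   a_{2i-1}, a_{2i} have indices j = 2(i-1), 2(i-1)+1 here. *)
Definition arc_end (j : 'I_n.*2) : 'I_n * bool :=
  (arc_crossing j, odd j == positive D (arc_crossing j)).

Definition crossing_block (c : 'I_n) : 'M[laurent2]_2 :=
  if positive D c then
    \matrix_(i, j) (nth [::]
      [:: [:: uvpow (-1) 0; 1 - uvpow (-1) (-1)];
          [:: 0           ; uvpow 0 (-1)       ]] i)`_j
  else
    \matrix_(i, j) (nth [::]
      [:: [:: uvpow 0 1    ; 0        ];
          [:: 1 - uvpow 1 1; uvpow 1 0]] i)`_j.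

Definition crossing_matrix : 'M[laurent2]_(n.*2) :=
  \matrix_(i, j)
    if arc_crossing i == arc_crossing j
    then crossing_block (arc_crossing i) (inord (odd i)) (inord (odd j))
    else 0.

Definition successor_matrix : 'M[laurent2]_(n.*2) :=
  \matrix_(i, j) (next (endpoints D) (arc_end i) == arc_end j)%:R.

Definition diagram_alexander : laurent2 :=
  if n == 0%N then 0 else \det (crossing_matrix - successor_matrix).

End Invariants.

(* The lowest power of u in f (and 0 if f = 0). *)
Definition min_upow (f : laurent2) : int :=
  let s := [seq e.1 | e <- msupp f] in \big[Order.min/head 0 s]_(i <- s) i.

Definition alexander_polynomial (n : nat) (D : gauss n) : laurent2 :=
  let f := diagram_alexander D in uvpow (- min_upow f) (- min_upow f) * f.

Definition ordered_pair (T : Type) (b : bool) (p q : T) : seq T :=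
  if b then [:: p; q] else [:: q; p].

(* Equality of diagrams up to renaming of the chords and choice of the point at
   which the circle is cut. *)
Definition gauss_iso (n : nat) (D D' : gauss n) : Prop :=
  exists (f : 'S_n) (k : nat),
    endpoints D' = rot k [seq (f p.1, p.2) | p <- endpoints D] /\
    (forall c, positive D' (f c) = positive D c).

(* D' has one more chord than D; the new chord ord0 is isolated, with either
   sign and either direction. *)
Definition reidemeister1 (n : nat) (D : gauss n) (D' : gauss n.+1) : Prop :=
  exists o : bool,
    endpoints D' =
      [:: (ord0, o); (ord0, ~~ o)] ++
      [seq (lift ord0 p.1, p.2) | p <- endpoints D] /\
    (forall c, positive D' (lift ord0 c) = positive D c).

(* D' has two more chords a, b than D, of opposite signs, with adjacent
   over-crossing endpoints and adjacent under-crossing endpoints; the order of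
   the latter tells whether the two strands are parallel or antiparallel. *)
Definition reidemeister2 (n : nat) (D : gauss n) (D' : gauss n.+2) : Prop :=
  let a : 'I_n.+2 := ord0 in
  let b : 'I_n.+2 := lift ord0 ord0 in
  let old (p : 'I_n * bool) := (lift ord0 (lift ord0 p.1), p.2) in
  exists (X Y : seq ('I_n * bool)) (o : bool),
    [/\ endpoints D = X ++ Y,
        endpoints D' =
          [:: (a, true); (b, true)] ++ map old X ++
          ordered_pair o (a, false) (b, false) ++ map old Y,
        positive D' a != positive D' b
      & forall c, positive D' (lift ord0 (lift ord0 c)) = positive D c].

(* a, b, c are the crossings top/middle, top/bottom, middle/bottom of the three
   strands.  The booleans t, m, l record the order in which the top, middle and
   bottom strand meet their two crossings, and r the order of the strands along
   the circle.  If x, y, z are the signed lengths of the sides of the triangle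
   and T, M, B the directions of the strands, then x T + z B = y M; taking the
   planar determinant with T and with B gives z [T,B] = y [T,M] and
   x [T,B] = y [M,B], where [T,M], [T,B], [M,B] have the signs of a, b, c.
   These are the two sign conditions, and they characterize the eight oriented
   versions of the move, each in both directions. *)
Definition reidemeister3 (n : nat) (D D' : gauss n) : Prop :=
  exists (a b c : 'I_n) (X Y Z : seq ('I_n * bool)) (t m l r : bool),
    let top t := ordered_pair t (a, true) (b, true) in
    let middle m := ordered_pair m (a, false) (c, true) in
    let bottom l := ordered_pair l (b, false) (c, false) in
    let word t m l := top t ++ X ++
      (if r then middle m ++ Y ++ bottom l else bottom l ++ Y ++ middle m)
      ++ Z in
    [/\ endpoints D = word t m l,
        endpoints D' = word (~~ t) (~~ m) (~~ l),
        positive D' =1 positive D,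
        (l == positive D b) = (m == positive D a)
      & (t == positive D b) = (m == positive D c)].

Inductive virtually_equivalent :
    forall n n' : nat, gauss n -> gauss n' -> Prop :=
| veq_refl n (D : gauss n) : virtually_equivalent D D
| veq_sym n n' (D : gauss n) (D' : gauss n') :
    virtually_equivalent D D' -> virtually_equivalent D' D
| veq_trans n n' n'' (D : gauss n) (D' : gauss n') (D'' : gauss n'') :
    virtually_equivalent D D' -> virtually_equivalent D' D'' ->
    virtually_equivalent D D''
| veq_iso n (D D' : gauss n) : gauss_iso D D' -> virtually_equivalent D D'
| veq_R1 n (D : gauss n) (D' : gauss n.+1) :
    reidemeister1 D D' -> virtually_equivalent D D'
| veq_R2 n (D : gauss n) (D' : gauss n.+2) :
    reidemeister2 D D' -> virtually_equivalent D D'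
| veq_R3 n (D D' : gauss n) :
    reidemeister3 D D' -> virtually_equivalent D D'.

(* A virtual knot is an equivalence class of Gauss diagrams. *)
Record virtual_knot := VirtualKnot {
  is_diagram_of : forall n : nat, gauss n -> Prop;
  virtual_knotP : exists (n : nat) (D : gauss n),
    forall (n' : nat) (D' : gauss n'),
      is_diagram_of D' <-> virtually_equivalent D D'
}.

Definition is_writhe_polynomial (K : virtual_knot) (W : laurent1) : Prop :=
  exists (n : nat) (D : gauss n),
    is_diagram_of K D /\ W = writhe_polynomial D.

Definition is_alexander_polynomial (K : virtual_knot) (Delta : laurent2) :
    Prop :=
  exists (n : nat) (D : gauss n),
    is_diagram_of K D /\ Delta = alexander_polynomial D.

(* Main.v *)
From HB Require Import structures.
Require Import Defs.
From mathcomp Require Import all_boot all_order all_fingroup all_algebra.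
From mathcomp Require Import finmap monalg.
From mathcomp Require Import zify ring.

Set Implicit Arguments.
Unset Strict Implicit.
Unset Printing Implicit Defensive.

Import Order.TTheory GRing.Theory Num.Theory.
Local Open Scope ring_scope.

(** Both sides are computed from a single function on the endpoints of a Gauss
    diagram, the [potential]: the sum of the endpoint signs met on the circle
    before a given endpoint.  As all the signs add up to 0, it increases by the
    sign of [p] from an endpoint [p] to the next one, also across the base
    point, and the index of a chord [c] is the potential of its under-crossing
    endpoint minus that of its over-crossing endpoint, plus the sign of [c].

    On the Alexander side, weight the arc arriving at [p] by
    [x_p = u ^ (- potential p)].  On the curve [u v = 1] the matrix
    [A = M - P] becomes [diag (t ^ (- sign p))] minus the permutation matrix of
    one cycle, and it kills the vector [x].  Hence over [Z[u^+-1, v^+-1]] one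
    has [A x = (1 - u v) b] for an explicit [b]
    ([mul_alexander_matrix_weight]), and multiplying by the adjugate of [A]
    gives [det A = (1 - u v) Delta'] with
    [Delta' = x_j^-1 (adj A b)_j] for any [j] ([det_of_mul_col]).  At
    [(t, t^-1)] the adjugate of a diagonal matrix minus a cycle is explicit
    ([adj_diag_sub_cycle]): its entry [(j, i)] is [x_j] divided by the weight of
    the arc after [i].  The over-crossing arc of a chord [c] then contributes
    [eps c] to [Delta' (t, t^-1)] and the under-crossing arc
    [- eps c t ^ Ind c] ([eval_weight_defect]), so that
    [- Delta' (t, t^-1)] is the sum of the [eps c (t ^ Ind c - 1)], which is
    the writhe polynomial of the diagram ([writhe_polynomial_sum]).

    The normalization multiplies the determinant by a power of [u v], which is
    1 at [(t, t^-1)].  The Alexander polynomial may therefore be computed on any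
    diagram of the knot, and only the writhe polynomial has to be shown
    invariant under the moves ([writhe_polynomial_equiv]).  Finally, [1 - u v]
    can be cancelled ([mulI_1Buv]), so the quotient is unique. *)

(** * Determinant and adjugate of a diagonal matrix minus a cycle *)

Lemma fconnect_ind (T : finType) (p : T -> T) (P : T -> Prop) :
  (forall i j, fconnect p i j) -> (forall i, P i -> P (p i)) ->
  forall i j, P i -> P j.
Proof.
move=> pT PS i j Pi; rewrite -(iter_findex (pT i j)).
by elim: (findex p i j) => //= k; apply: PS.
Qed.

Lemma odd_perm_cycle n (p : 'S_n) :
  (0 < n)%N -> (forall i j, fconnect p i j) -> odd_perm p = ~~ odd n.
Proof.
move=> n_gt0 pT; pose i0 := Ordinal n_gt0.
suff -> : odd_perm p = odd n (+) odd #|[set [set: 'I_n]]|.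
  by rewrite cards1 addbT.
rewrite /odd_perm card_ord; congr (_ (+) odd #|pred_of_set _|).
apply/setP=> A; rewrite inE.
have porT i : porbit p i = setT.
  apply/setP=> j; rewrite inE; apply/porbitP.
  by exists (findex p i j); rewrite permX iter_findex.
apply/imsetP/eqP => [[i _ ->] // | ->].
by exists i0.
Qed.

(** In the Leibniz formula a permutation with a nonzero term sends each [i] to
    [i] or to [p i].  If it moves one point it must also move the next point of
    the cycle, since it is injective; so only the identity and [p] contribute,
    and the sign of an [n]-cycle cancels the [n] minus signs up to one. *)
Lemma det_diag_sub_cycle (R : comPzRingType) n (d : 'rV[R]_n) (p : 'S_n) :
  (1 < n)%N -> (forall i j, fconnect p i j) ->
  \det (diag_mx d - perm_mx p) = \prod_i d 0 i - 1.
Proof.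
move=> n_gt1 pT.
have n_gt0 : (0 < n)%N by apply: ltnW.
have pF i : p i != i.
  apply/eqP => pi; have sub1 j : j = i.
    by apply: (@fconnect_ind _ p (fun j => j = i) pT _ i) => // k ->.
  have := sub1 (Ordinal n_gt1); rewrite -(sub1 (Ordinal n_gt0)).
  by move/(congr1 val).
have p1 : p != 1%g.
  by apply/eqP => p1; have := pF (Ordinal n_gt0); rewrite p1 perm1 eqxx.
rewrite /determinant (bigD1 1%g) //= (bigD1 p) //=.
rewrite odd_perm1 expr0 mul1r [X in _ + (_ + X)]big1 ?addr0.
  congr (_ + _).
    by apply: eq_bigr => i _; rewrite !mxE perm1 eqxx (negbTE (pF i)) subr0.
  rewrite (eq_bigr (fun _ => -1)); last first.
    by move=> i _; rewrite !mxE eqxx eq_sym (negbTE (pF i)) mulr0n sub0r.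
  rewrite prodr_const card_ord odd_perm_cycle // -[X in _ * X]signr_odd.
  by rewrite -signr_addb addNb addbb.
move=> s /andP[s1 sp].
case: (boolP [exists i, (s i != i) && (s i != p i)]) => [|all_ip].
  move=> /existsP[i /andP[si sip]].
  rewrite (bigD1 i) //= !mxE [i == _]eq_sym (negbTE si).
  by rewrite [p i == _]eq_sym (negbTE sip) subrr mul0r mulr0.
have ip i : s i = i \/ s i = p i.
  move/existsPn: all_ip => /(_ i); rewrite negb_and !negbK.
  by case/orP => /eqP; [left | right].
have step i : s i = p i -> s (p i) = p (p i).
  move=> si; case: (ip (p i)) => // spi.
  have := pF i; rewrite -{2}si in spi; move/perm_inj: spi => ->.
  by rewrite eqxx.
case: (boolP [exists i, s i == p i]) => [/existsP[i /eqP si] | /existsPn no].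
  by case/eqP: sp; apply/permP=> j; apply: (@fconnect_ind _ p _ pT step i).
case/eqP: s1; apply/permP=> j; rewrite perm1; case: (ip j) => // sj.
by have := no j; rewrite sj eqxx.
Qed.

(** The cofactor is the change of the determinant when the diagonal entry at
    [i] grows by 1, which [det_diag_sub_cycle] gives. *)
Lemma cofactor_diag_sub_cycle (R : comPzRingType) n (d : 'rV[R]_n)
    (p : 'S_n) i :
  (1 < n)%N -> (forall i j, fconnect p i j) ->
  cofactor (diag_mx d - perm_mx p) i i = \prod_(j | j != i) d 0 j.
Proof.
move=> n_gt1 pT.
pose d' : 'rV_n := \row_j (d 0 j + (j == i)%:R).
have dd' j : j != i -> d' 0 j = d 0 j.
  by move=> ji; rewrite mxE (negbTE ji) addr0.
(* Row [i], the only one where the matrices differ, is deleted. *)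
have cof j : cofactor (diag_mx d' - perm_mx p) i j =
             cofactor (diag_mx d - perm_mx p) i j.
  congr (_ * \det _); apply/matrixP=> k l; rewrite !mxE.
  by rewrite eq_sym (negbTE (neq_lift i k)) addr0.
have := erefl (\det (diag_mx d' - perm_mx p)).
rewrite {1}(expand_det_row _ i) (bigD1 i) //=.
rewrite (eq_bigr (fun j => (diag_mx d - perm_mx p) i j *
             cofactor (diag_mx d - perm_mx p) i j)); last first.
  by move=> j ji; rewrite cof !mxE eq_sym (negbTE ji) !mulr0n.
have -> : (diag_mx d' - perm_mx p) i i = 1 + (diag_mx d - perm_mx p) i i.
  by rewrite !mxE !eqxx !mulr1n addrA [1 + _]addrC.
rewrite cof mulrDl mul1r -addrA.
have <- := bigD1 i (F := fun j => (diag_mx d - perm_mx p) i j *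
             cofactor (diag_mx d - perm_mx p) i j) (erefl true).
have prod_d' : \prod_j d' 0 j = \prod_(j | j != i) d 0 j + \prod_j d 0 j.
  rewrite (bigD1 i) //= (eq_bigr _ dd') mxE eqxx mulrDl mul1r addrC.
  by rewrite [X in _ = _ + X](bigD1 i).
by rewrite -expand_det_row !det_diag_sub_cycle // prod_d' -addrA => /addIr.
Qed.

(** The matrix has determinant 0 and kernel vector [x].  Reading
    [adj C * C = 0] in row [i] shows that the left-hand side does not depend on
    [j]; for [j = i] it is given by the diagonal cofactor. *)
Lemma adj_diag_sub_cycle (R : comPzRingType) n (d : 'rV[R]_n) (p : 'S_n)
    (x : 'I_n -> R) i j :
  (1 < n)%N -> (forall i j, fconnect p i j) -> \prod_i d 0 i = 1 ->
  (forall i, x (p i) = d 0 i * x i) ->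
  (\adj (diag_mx d - perm_mx p)) i j * x (p j) = x i.
Proof.
move=> n_gt1 pT d1 xp.
set C := diag_mx d - perm_mx p.
have adjC k : (\adj C) i (p k) * d 0 (p k) = (\adj C) i k.
  have := congr1 (fun A : 'M_n => A i (p k)) (mul_adj_mx C).
  rewrite det_diag_sub_cycle // d1 subrr [RHS]mxE mul0rn.
  rewrite mulmxBr mul_mx_diag -[in perm_mx p](invgK p) -col_permE !mxE permK.
  by move=> /eqP; rewrite subr_eq0 => /eqP.
apply: (@fconnect_ind _ p (fun k => (\adj C) i k * x (p k) = x i) pT _ i).
  move=> k <-; rewrite (xp (p k)) mulrA adjC //.
rewrite mxE cofactor_diag_sub_cycle // xp mulrA [_ * d 0 i]mulrC.
have <- : \prod_k d 0 k = d 0 i * \prod_(k | k != i) d 0 k by apply: bigD1.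
by rewrite d1 mul1r.
Qed.

(** * Prefix sums along a cyclic word *)

Definition prefix_sum (T : eqType) (V : zmodType) (h : T -> V) (s : seq T)
    (z : T) : V := \sum_(y <- take (index z s) s) h y.

Lemma prefix_sum_cat (T : eqType) (V : zmodType) (h : T -> V) s1 s2 z :
  prefix_sum h (s1 ++ s2) z =
  if z \in s1 then prefix_sum h s1 z
  else \sum_(y <- s1) h y + prefix_sum h s2 z.
Proof.
rewrite /prefix_sum index_cat; case: ifP => zs1.
  by rewrite take_cat index_mem zs1.
by rewrite take_cat ltnNge leq_addr addKn big_cat.
Qed.

Lemma prefix_sum_cons (T : eqType) (V : zmodType) (h : T -> V) y s z :
  prefix_sum h (y :: s) z = if z == y then 0 else h y + prefix_sum h s z.
Proof.
by rewrite /prefix_sum /= eq_sym; case: eqP => _; rewrite ?big_nil ?big_cons.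
Qed.

Lemma prefix_sum_map (T T' : eqType) (V : zmodType) (h : T -> V) (h' : T' -> V)
    (f : T -> T') s z :
  injective f -> (forall y, h' (f y) = h y) ->
  prefix_sum h' (map f s) (f z) = prefix_sum h s z.
Proof.
move=> f_inj hf; rewrite /prefix_sum index_map // -map_take big_map.
exact: eq_bigr.
Qed.

(** Because the total is 0, moving the base point of a cyclic word changes all
    prefix sums by the same constant. *)
Lemma prefix_sum_rot (T : eqType) (V : zmodType) (h : T -> V) k s z :
  uniq s -> \sum_(y <- s) h y = 0 -> z \in s ->
  prefix_sum h (rot k s) z = prefix_sum h s z - \sum_(y <- take k s) h y.
Proof.
rewrite /rot; have := cat_take_drop k s.
move: (take k s) (drop k s) => s1 s2 <-{k s}.
rewrite cat_uniq mem_cat !prefix_sum_cat big_cat /= => /and3P[_ disj _].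
move/eqP; rewrite addr_eq0 => /eqP tot; case: (boolP (z \in s1)) => [zs1 _|zs1].
  have /negbTE -> : z \notin s2.
    by apply: contra disj => zs2; apply/hasP; exists z.
  by rewrite tot opprK addrC.
by move=> /= ->; rewrite addrC addKr.
Qed.

(** The wrap-around case is where the vanishing of the total is used: the base
    point is moved to [z], and then [next s z] is the second letter, or [z]
    itself if [z] is the only one. *)
Lemma prefix_sum_next (T : eqType) (V : zmodType) (h : T -> V) s z :
  uniq s -> \sum_(y <- s) h y = 0 -> z \in s ->
  prefix_sum h s (next s z) = prefix_sum h s z + h z.
Proof.
move=> s_uniq tot zs; have [k s' rot_s] := rot_to zs.
have pre y : y \in s -> prefix_sum h s y =
    prefix_sum h (z :: s') y + \sum_(w <- take k s) h w.
  by move=> ys; rewrite -rot_s prefix_sum_rot // subrK.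
rewrite !pre ?mem_next // -(next_rot k s_uniq) rot_s addrAC; congr (_ + _).
rewrite !prefix_sum_cons eqxx add0r /=.
have perm_s : perm_eq (rot k s) s by apply/permPl/perm_rot.
have := tot; rewrite -(perm_big _ perm_s) rot_s big_cons.
case: s' rot_s {pre} => [|y s'] rot_s; rewrite /= !eqxx.
  by rewrite big_nil addr0 => ->.
have : uniq (rot k s) by rewrite rot_uniq.
rewrite rot_s /= inE negb_or eq_sym => /andP[/andP[/negbTE -> _] _] _.
by rewrite prefix_sum_cons eqxx addr0.
Qed.

Lemma sum_arc (T : eqType) (V : zmodType) (h : T -> V) s x y :
  uniq s -> \sum_(z <- s) h z = 0 -> x \in s -> y \in s ->
  \sum_(z <- arc s x y) h z = prefix_sum h s y - prefix_sum h s x.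
Proof. by move=> s_uniq tot xs ys; rewrite -prefix_sum_rot. Qed.

Lemma perm_ordered_pair (T : eqType) b (p q : T) :
  perm_eq (ordered_pair b p q) [:: p; q].
Proof. by case: b => //=; rewrite (perm_catC [:: q] [:: p]). Qed.

Lemma uniq_swap (T : eqType) s1 s2 b (p q : T) :
  uniq (s1 ++ ordered_pair (~~ b) p q ++ s2) =
  uniq (s1 ++ ordered_pair b p q ++ s2).
Proof.
apply: perm_uniq; rewrite perm_cat2l perm_cat2r.
by rewrite (permPl (perm_ordered_pair _ _ _)) perm_sym perm_ordered_pair.
Qed.

(** The effect on the prefix sum at [z] of exchanging the adjacent letters [p]
    and [q], which are in this order if [b]: each of them gains or loses the
    value of the other, and no other letter is affected. *)
Definition swap_shift (T : eqType) (V : zmodType) (h : T -> V) b p q z : V :=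
  if b then (if z == p then h q else 0) - (if z == q then h p else 0)
  else (if z == q then h p else 0) - (if z == p then h q else 0).

Lemma prefix_sum_swap (T : eqType) (V : zmodType) (h : T -> V) s1 s2 b p q z :
  uniq (s1 ++ ordered_pair b p q ++ s2) ->
  prefix_sum h (s1 ++ ordered_pair (~~ b) p q ++ s2) z =
  prefix_sum h (s1 ++ ordered_pair b p q ++ s2) z + swap_shift h b p q z.
Proof.
move=> s_uniq; have [pq ps1 qs1] : [/\ p != q, p \notin s1 & q \notin s1].
  have : uniq (s1 ++ [:: p; q] ++ s2).
    by move: s_uniq; case: b => //; rewrite -uniq_swap.
  rewrite uniq_catCA /= !inE !mem_cat !negb_or.
  by case/and3P=> /and3P[-> -> _] /andP[-> _] _.
rewrite /swap_shift !prefix_sum_cat {s_uniq}.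
have qp : (q == p) = false by rewrite eq_sym (negbTE pq).
have [->|zp] := eqVneq z p.
  rewrite (negbTE ps1) (negbTE pq).
  case: b => /=; rewrite !inE !prefix_sum_cons !eqxx ?orbT (negbTE pq) /=.
    by rewrite subr0 !addr0.
  by rewrite sub0r !addr0 addrK.
have [->|zq] := eqVneq z q.
  rewrite (negbTE qs1).
  case: b => /=; rewrite !inE !prefix_sum_cons !eqxx ?orbT qp /=.
    by rewrite sub0r !addr0 addrK.
  by rewrite subr0 !addr0.
rewrite subrr if_same addr0; case: (z \in s1) => //.
congr (_ + _); case: b => /=; rewrite !inE (negbTE zp) (negbTE zq) /=;
by congr (_ + _); rewrite !big_cons big_nil !addr0 addrC.
Qed.

(** * Laurent polynomials *)

(** [mcoeff] retyped on [group_ring], so that it carries an additive structure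
    for the ring operations there. *)
Definition gcoef (K : zmodType) (k : K) (f : group_ring K) : int := mcoeff k f.

Lemma gcoef_is_zmod_morphism (K : zmodType) (k : K) : zmod_morphism (gcoef k).
Proof. exact: mcoeffB. Qed.

HB.instance Definition _ (K : zmodType) (k : K) :=
  GRing.isZmodMorphism.Build (group_ring K) int (gcoef k)
    (gcoef_is_zmod_morphism k).

Lemma gcoef_mono (K : zmodType) (k l : K) : gcoef l (gmono k) = (k == l)%:R.
Proof. exact: mcoeffU. Qed.

Lemma uvpowD i j k l : uvpow i j * uvpow k l = uvpow (i + k) (j + l).
Proof. by rewrite -gmonoD. Qed.

Lemma tpowD i j : tpow (i + j) = tpow i * tpow j.
Proof. exact: gmonoD. Qed.

Lemma eval_t_tinv_is_zmod_morphism : zmod_morphism eval_t_tinv.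
Proof. exact: mmapB. Qed.

HB.instance Definition _ :=
  GRing.isZmodMorphism.Build laurent2 laurent1 eval_t_tinv
    eval_t_tinv_is_zmod_morphism.

Lemma eval_uvpow i j : eval_t_tinv (uvpow i j) = tpow (i - j).
Proof. by rewrite /eval_t_tinv mmapU mul1r tpowD. Qed.

Lemma eval_t_tinv_is_monoid_morphism : monoid_morphism eval_t_tinv.
Proof.
split=> [|f g]; first by rewrite -[1]gmono0 eval_uvpow subrr.
have -> : f * g = \sum_(k <- msupp f) \sum_(l <- msupp g)
  (<< f@_k * g@_l *g k + l >> : laurent2) by [].
have shuffle (R : comPzRingType) (a b c d x y : R) :
    a * b * (c * d * (x * y)) = a * (c * x) * (b * (d * y)).
  by rewrite [c * d * _]mulrACA [LHS]mulrACA.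
rewrite raddf_sum /= [eval_t_tinv f]mmapE [eval_t_tinv g]mmapE mulr_suml.
apply: eq_bigr => k _; rewrite raddf_sum /= mulr_sumr; apply: eq_bigr => l _.
rewrite /eval_t_tinv mmapU /= opprD !tpowD intrM.
exact: shuffle.
Qed.

HB.instance Definition _ :=
  GRing.isMonoidMorphism.Build laurent2 laurent1 eval_t_tinv
    eval_t_tinv_is_monoid_morphism.

Lemma gcoef_monoM (K : zmodType) (k l : K) (f : group_ring K) :
  gcoef k (gmono l * f) = gcoef (k - l) f.
Proof.
rewrite -[gmono l * f]/(gmul << 1 *g l >> f) gmulUg [in RHS](monalgE f).
rewrite /gcoef !raddf_sum /=; apply: eq_bigr => k' _.
by rewrite !mcoeffU mul1r [k' == _]eq_sym subr_eq addrC [_ == k]eq_sym.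
Qed.

(** If [(1 - u v) d = 0], then the coefficients of [d] are constant along the
    direction [(1, 1)]; since the support is finite, they are 0. *)
Lemma mulI_1Buv : injective ( *%R (1 - uvpow 1 1)).
Proof.
move=> f g /eqP; rewrite -subr_eq0 -mulrBr; set d := f - g => /eqP d0.
apply/eqP; rewrite -subr_eq0 -/d; apply/eqP/malgP => k; rewrite mcoeff0.
apply/eqP; apply: contraT => dk.
pose shift i := k - (1, 1) *+ i : int * int.
have shift_supp i : shift i \in msupp d.
  rewrite -mcoeff_neq0; suff -> : d@_(shift i) = d@_k by [].
  elim: i => [|i <-]; first by rewrite /shift subr0.
  move/(congr1 (gcoef (shift i))): d0.
  rewrite mulrBl mul1r raddfB /= gcoef_monoM raddf0 => /eqP.
  by rewrite subr_eq0 /shift mulrSr opprD addrA => /eqP/esym.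
have shift_inj : injective shift.
  have fstM i : ((1, 1) *+ i : int * int).1 = i.
    by elim: i => // i IHi; rewrite mulrS /= IHi intS.
  by move=> i j /addrI/oppr_inj/(congr1 fst); rewrite !fstM => - [].
have := @uniq_leq_size _ (map shift (iota 0 (size (msupp d)).+1)) (msupp d).
rewrite (map_inj_uniq shift_inj) iota_uniq size_map size_iota ltnn.
by apply => // _ /mapP[i _ ->].
Qed.

(** * The potential of a Gauss diagram and the writhe polynomial *)

(** The Alexander numbering of the circle: an arc is numbered by the signs of
    the endpoints met before it. *)
Definition potential n (D : gauss n) (p : 'I_n * bool) : int :=
  prefix_sum (endpoint_sign D) (endpoints D) p.

Lemma mem_endpoints n (D : gauss n) p : p \in endpoints D.
Proof. by rewrite (perm_mem (endpointsP D)) mem_enum. Qed.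

Lemma uniq_endpoints n (D : gauss n) : uniq (endpoints D).
Proof. by rewrite (perm_uniq (endpointsP D)) enum_uniq. Qed.

Lemma sum_endpoint_sign n (D : gauss n) :
  \sum_(p <- endpoints D) endpoint_sign D p = 0.
Proof.
rewrite (perm_big _ (endpointsP D)) big_enum /=.
rewrite -(pair_big xpredT xpredT (fun c b => endpoint_sign D (c, b))) /=.
by rewrite big1 // => c _; rewrite big_bool /endpoint_sign /= addNr.
Qed.

Lemma potential_next n (D : gauss n) p :
  potential D (next (endpoints D) p) = potential D p + endpoint_sign D p.
Proof.
exact: prefix_sum_next (uniq_endpoints D) (sum_endpoint_sign D)
  (mem_endpoints D p).
Qed.

(** The last term removes the over-crossing endpoint, whose sign is
    [- crossing_sign D c], from the arc. *)
Lemma chord_indexE n (D : gauss n) c :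
  chord_index D c =
    potential D (c, false) - potential D (c, true) + crossing_sign D c.
Proof.
rewrite -(sum_arc (uniq_endpoints D) (sum_endpoint_sign D)) ?mem_endpoints //.
rewrite /chord_index /arc rot_index ?mem_endpoints //= xpair_eqE andbF big_cons.
by rewrite addrAC addNr add0r.
Qed.

(** The correction by the total writhe in degree 0 amounts to replacing each
    [t ^ Ind c] by [t ^ Ind c - 1]. *)
Lemma writhe_polynomial_sum n (D : gauss n) :
  writhe_polynomial D =
    \sum_c (tpow (chord_index D c) - 1) *~ crossing_sign D c.
Proof.
apply/malgP=> k; rewrite writhe_polynomialE -/(gcoef k _) raddf_sum.
have coef c : gcoef k ((tpow (chord_index D c) - 1) *~ crossing_sign D c) =
    crossing_sign D c *+ (chord_index D c == k) - crossing_sign D c *+ (0 == k).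
  have bool_mulz (e : bool) (s : int) : e%:R *~ s = s *+ e.
    by case: e; rewrite ?mul0rz ?intz.
  by rewrite raddfMz raddfB /= /tpow -gmono0 !gcoef_mono mulrzBl !bool_mulz.
rewrite (eq_bigr _ (fun c _ => coef c)).
rewrite sumrB [X in _ - X]sumrMnl /knot_writhe /diagram_writhe /writhe.
rewrite [0 == k]eq_sym.
have [->|_] := eqVneq k 0; rewrite ?mulr1n ?subr0; try congr (_ - _);
by rewrite big_mkcond /=; apply: eq_bigr => c _; case: ifP.
Qed.

(** * Invariance of the writhe polynomial *)

(** Moving the base point shifts the potential by a constant, which cancels in
    the index of each chord. *)
Lemma writhe_polynomial_iso n (D D' : gauss n) :
  gauss_iso D D' -> writhe_polynomial D = writhe_polynomial D'.
Proof.
case=> f [k [D'E posE]]; rewrite !writhe_polynomial_sum.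
rewrite [RHS](reindex_inj (@perm_inj _ f)) /=; apply: eq_bigr => c _.
have signE d : crossing_sign D' (f d) = crossing_sign D d.
  by rewrite /crossing_sign posE.
pose g (p : 'I_n * bool) := (f p.1, p.2).
have potE d b : potential D' (f d, b) =
    potential D (d, b) -
      \sum_(p <- take k (map g (endpoints D))) endpoint_sign D' p.
  rewrite /potential D'E prefix_sum_rot.
  - congr (_ - _); rewrite -[(f d, b)]/(g (d, b)).
    apply: prefix_sum_map => [[d1 b1] [d2 b2] [/perm_inj -> ->] // | [d1 b1]].
    by rewrite /endpoint_sign /= signE.
  - by rewrite -(rot_uniq k) -D'E uniq_endpoints.
  - have perm_s : perm_eq (endpoints D') (map g (endpoints D)).
      by rewrite D'E; apply/permPl/perm_rot.
    by rewrite -(perm_big _ perm_s) sum_endpoint_sign.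
  - by rewrite -(mem_rot k) -D'E mem_endpoints.
by rewrite !chord_indexE signE !potE opprB addrA subrK.
Qed.

(** The two endpoints of the new chord are adjacent and have opposite signs:
    they do not change the potential of the others, and the new chord has
    index 0, so its term [t ^ 0 - 1] vanishes. *)
Lemma writhe_polynomial_R1 n (D : gauss n) (D' : gauss n.+1) :
  reidemeister1 D D' -> writhe_polynomial D = writhe_polynomial D'.
Proof.
case=> o [D'E posE]; rewrite !writhe_polynomial_sum big_ord_recl.
have signE c : crossing_sign D' (lift ord0 c) = crossing_sign D c.
  by rewrite /crossing_sign posE.
have pot0 b : potential D' (ord0, b) =
    if b == o then 0 else endpoint_sign D' (ord0, o).
  rewrite /potential D'E /= !prefix_sum_cons !xpair_eqE eqxx /=.
  by case: eqP => //; case: b o {D'E} => [] []; rewrite ?addr0.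
have potE c b : potential D' (lift ord0 c, b) = potential D (c, b).
  rewrite /potential D'E /= !prefix_sum_cons !xpair_eqE /= addrA.
  have -> : endpoint_sign D' (ord0, o) + endpoint_sign D' (ord0, ~~ o) = 0.
    by case: (o); rewrite /endpoint_sign /= ?addNr ?addrN.
  rewrite add0r.
  pose g (p : 'I_n * bool) := (lift ord0 p.1, p.2).
  rewrite -[(_, b)]/(g (c, b)).
  apply: prefix_sum_map => [[d1 b1] [d2 b2] /eqP | [d1 b1]].
    by rewrite xpair_eqE (inj_eq lift_inj) => /andP[/eqP/= -> /eqP/= ->].
  by rewrite /endpoint_sign /= signE.
have -> : chord_index D' ord0 = 0.
  rewrite chord_indexE !pot0; case: (o); rewrite /endpoint_sign /=.
    by rewrite subr0 addNr.
  by rewrite sub0r addNr.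
rewrite /tpow gmono0 subrr mul0rz add0r; apply: eq_bigr => c _.
by rewrite !chord_indexE signE !potE.
Qed.

(** Each new pair of adjacent endpoints has opposite signs, so the old
    potentials are unchanged; the two new chords have the same index and
    opposite signs, so their terms cancel. *)
Lemma writhe_polynomial_R2 n (D : gauss n) (D' : gauss n.+2) :
  reidemeister2 D D' -> writhe_polynomial D = writhe_polynomial D'.
Proof.
case=> X [Y [o [DE D'E posab posE]]].
set a := ord0 in D'E posab *; set b := lift ord0 ord0 in D'E posab *.
pose g (p : 'I_n * bool) := (lift ord0 (lift ord0 p.1), p.2).
have signE c : crossing_sign D' (lift ord0 (lift ord0 c)) = crossing_sign D c.
  by rewrite /crossing_sign posE.
have signb : crossing_sign D' b = - crossing_sign D' a.
  by rewrite /crossing_sign; case: ifP posab; case: ifP.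
have g_sign p : endpoint_sign D' (g p) = endpoint_sign D p.
  by case: p => c e; rewrite /endpoint_sign /= signE.
have g_inj : injective g.
  move=> [c1 e1] [c2 e2] /eqP; rewrite xpair_eqE !(inj_eq lift_inj).
  by move=> /andP[/eqP/= -> /eqP/= ->].
have aX e s : (a, e) \notin map g s.
  by apply/mapP => -[[c e'] _ []].
have bX e s : (b, e) \notin map g s.
  by apply/mapP => -[[c e'] _ []].
have potE c e : potential D' (lift ord0 (lift ord0 c), e) = potential D (c, e).
  rewrite /potential D'E DE /= !prefix_sum_cons !xpair_eqE /= addrA.
  have -> : endpoint_sign D' (a, true) + endpoint_sign D' (b, true) = 0.
    by rewrite /endpoint_sign /= signb addrN.
  rewrite add0r.
  rewrite -[(_, e)]/(g (c, e)) !prefix_sum_cat mem_map //.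
  rewrite !(prefix_sum_map (h := endpoint_sign D)) //.
  have -> : g (c, e) \in ordered_pair o (a, false) (b, false) = false.
    by case: (o).
  case: ifP => // _; rewrite big_map (eq_bigr _ (fun p _ => g_sign p)).
  congr (_ + _); case: (o) => /=; rewrite !big_cons big_nil /endpoint_sign /=.
    by rewrite signb addr0 addrN add0r.
  by rewrite signb addr0 addNr add0r.
have idx_ab : chord_index D' a = chord_index D' b.
  rewrite !chord_indexE /potential D'E /= !prefix_sum_cons.
  rewrite !prefix_sum_cat !(negbTE (aX _ _)) !(negbTE (bX _ _)).
  rewrite !xpair_eqE !eqxx /= /endpoint_sign /= signb.
  by case: (o) => /=; rewrite !prefix_sum_cons !xpair_eqE !eqxx /= ?signb; ring.
have pair_ab : (tpow (chord_index D' a) - 1) *~ crossing_sign D' a +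
    (tpow (chord_index D' b) - 1) *~ crossing_sign D' b = 0.
  rewrite idx_ab signb; move: (tpow _ - 1) (crossing_sign D' a) => y s.
  by rewrite mulrNz addrN.
rewrite !writhe_polynomial_sum 2!big_ord_recl -/a -/b addrA pair_ab add0r.
by apply: eq_bigr => c _; rewrite !chord_indexE !potE signE.
Qed.

Lemma count_ordered_pair (T : Type) (P : pred T) b p q :
  count P (ordered_pair b p q) = (P p + P q)%N.
Proof. by case: b; rewrite /= addn0 // addnC. Qed.

(** The form in which a third Reidemeister move acts on a Gauss word. *)
Lemma prefix_sum_swap3 (T : eqType) (V : zmodType) (h : T -> V) X Y Z t m l
    p1 q1 p2 q2 p3 q3 z :
  let word t m l := ordered_pair t p1 q1 ++ X ++ ordered_pair m p2 q2 ++
    Y ++ ordered_pair l p3 q3 ++ Z in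
  uniq (word t m l) ->
  prefix_sum h (word (~~ t) (~~ m) (~~ l)) z =
  prefix_sum h (word t m l) z + (swap_shift h t p1 q1 z +
    swap_shift h m p2 q2 z + swap_shift h l p3 q3 z).
Proof.
move=> word word_uniq.
have word1 t' m' l' : word t' m' l' = [::] ++ ordered_pair t' p1 q1 ++
    (X ++ ordered_pair m' p2 q2 ++ Y ++ ordered_pair l' p3 q3 ++ Z) by [].
have word2 t' m' l' : word t' m' l' = (ordered_pair t' p1 q1 ++ X) ++
    ordered_pair m' p2 q2 ++ (Y ++ ordered_pair l' p3 q3 ++ Z).
  by rewrite /word -!catA.
have word3 t' m' l' : word t' m' l' =
    (ordered_pair t' p1 q1 ++ X ++ ordered_pair m' p2 q2 ++ Y) ++
    ordered_pair l' p3 q3 ++ Z by rewrite /word -!catA.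
have word_uniq1 : uniq (word (~~ t) m l) by rewrite word1 uniq_swap -word1.
have word_uniq2 : uniq (word (~~ t) (~~ m) l) by rewrite word2 uniq_swap -word2.
rewrite word3 prefix_sum_swap -word3 // word2 prefix_sum_swap -word2 //.
by rewrite word1 prefix_sum_swap -word1 // !addrA.
Qed.

(** The move performs three swaps of adjacent endpoints.  They change the
    potentials of the six endpoints involved, but under the sign conditions the
    two endpoints of each chord are shifted by the same amount, so that no index
    changes. *)
Lemma writhe_polynomial_R3 n (D D' : gauss n) :
  reidemeister3 D D' -> writhe_polynomial D = writhe_polynomial D'.
Proof.
case=> a [b [c [X [Y [Z [t [m [l [r [/= DE D'E posE lm tm]]]]]]]]]].
have signE d : crossing_sign D' d = crossing_sign D d.
  by rewrite /crossing_sign posE.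
have potE p : potential D' p = potential D p +
    (swap_shift (endpoint_sign D) t (a, true) (b, true) p +
     swap_shift (endpoint_sign D) m (a, false) (c, true) p +
     swap_shift (endpoint_sign D) l (b, false) (c, false) p).
  have -> : potential D' p = prefix_sum (endpoint_sign D) (endpoints D') p.
    by apply: eq_bigr => q _; rewrite /endpoint_sign signE.
  have := uniq_endpoints D; rewrite /potential DE D'E.
  case: (r); rewrite -!catA => Duniq; first exact: prefix_sum_swap3.
  by rewrite prefix_sum_swap3 // [X in _ = _ + X]addrAC.
(* The three crossings are distinct because each endpoint occurs once. *)
have mem_once p : (count_mem p (endpoints D) <= 1)%N.
  by rewrite count_uniq_mem ?uniq_endpoints ?leq_b1.
have ab : a != b.
  apply/eqP=> ab; have := mem_once (a, true); rewrite DE -ab.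
  by rewrite !count_cat count_ordered_pair /= eqxx; lia.
have bc : b != c.
  apply/eqP=> bc; have := mem_once (b, false); rewrite DE -bc.
  by case: (r); rewrite !count_cat !count_ordered_pair /= eqxx; clear; lia.
have ac : a != c.
  apply/eqP=> ac; have := mem_once (a, false); rewrite DE -ac.
  by case: (r); rewrite !count_cat !count_ordered_pair /= eqxx; clear; lia.
have indexE d : chord_index D' d = chord_index D d.
  rewrite !chord_indexE signE !potE; congr (_ + _).
  rewrite opprD addrACA -[RHS]addr0; congr (_ + _); apply/eqP.
  (* It remains to compare the shifts at the two endpoints of [d], which is a
     finite check over the signs and the orders. *)
  rewrite subr_eq0 /swap_shift /endpoint_sign /crossing_sign !xpair_eqE /=.
  rewrite !andbF !andbT.
  have [->|da] := eqVneq d a.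
    rewrite (negbTE ab) (negbTE ac); move: lm tm.
    by case: (positive D a) (positive D b) (positive D c) t m l {DE D'E potE}
      => [] [] [] [] [] [].
  have [->|db] := eqVneq d b.
    rewrite (negbTE bc); move: lm tm.
    by case: (positive D a) (positive D b) (positive D c) t m l {DE D'E potE}
      => [] [] [] [] [] [].
  have [_|_] := eqVneq d c; last by rewrite !(subrr, if_same).
  move: lm tm.
  by case: (positive D a) (positive D b) (positive D c) t m l {DE D'E potE}
    => [] [] [] [] [] [].
rewrite !writhe_polynomial_sum; apply: eq_bigr => d _.
by rewrite indexE signE.
Qed.

Lemma writhe_polynomial_equiv n n' (D : gauss n) (D' : gauss n') :
  virtually_equivalent D D' -> writhe_polynomial D = writhe_polynomial D'.
Proof.
elim=> // {n n' D D'}.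
- by move=> n n' n'' D D' D'' _ -> _ ->.
- exact: writhe_polynomial_iso.
- exact: writhe_polynomial_R1.
- exact: writhe_polynomial_R2.
- exact: writhe_polynomial_R3.
Qed.

(** * Arcs and the matrices of the Alexander polynomial *)

Lemma arc_to_subproof n (D : gauss n) (p : 'I_n * bool) :
  (p.1.*2 + (p.2 == positive D p.1) < n.*2)%N.
Proof. by have := ltn_ord p.1; case: eqP => _; lia. Qed.

Definition arc_to n (D : gauss n) (p : 'I_n * bool) : 'I_n.*2 :=
  Ordinal (arc_to_subproof D p).

Lemma arc_toK n (D : gauss n) : cancel (arc_to D) (arc_end D).
Proof.
move=> [c e]; rewrite /arc_end.
have -> : arc_crossing (arc_to D (c, e)) = c.
  by apply: val_inj => /=; case: eqP => _; lia.
congr (_, _); rewrite /= oddD odd_double addFb oddb.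
by case: e (positive D c) => [] [].
Qed.

Lemma arc_endK n (D : gauss n) : cancel (arc_end D) (arc_to D).
Proof.
move=> j; apply: val_inj; rewrite /= -[RHS]odd_double_half addnC.
by case: (odd j) (positive D _) => [] [].
Qed.

Lemma next_arc_inj n (D : gauss n) :
  injective (fun j => arc_to D (next (endpoints D) (arc_end D j))).
Proof.
move=> i j /(can_inj (arc_toK D)).
move/(can_inj (prev_next (uniq_endpoints D))).
exact: (can_inj (arc_endK D)).
Qed.

Definition next_arc n (D : gauss n) : 'S_(n.*2) := perm (@next_arc_inj n D).

Lemma arc_end_next n (D : gauss n) j :
  arc_end D (next_arc D j) = next (endpoints D) (arc_end D j).
Proof. by rewrite permE arc_toK. Qed.

(** The arcs follow each other as the endpoints do on a single circle. *)
Lemma next_arc_cyclic n (D : gauss n) i j : fconnect (next_arc D) i j.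
Proof.
have := fconnect_cycle (cycle_next (uniq_endpoints D))
  (mem_endpoints D (arc_end D i)) (arc_end D j).
rewrite mem_endpoints => /iter_findex.
move: (findex _ _ _) => k; elim: k j => [|k IHk] j /=.
  by move/(can_inj (arc_endK D)) ->.
set p := iter k _ _ => pj.
apply: connect_trans (IHk (arc_to D p) _) _; first by rewrite arc_toK.
suff -> : j = next_arc D (arc_to D p) by apply: fconnect1.
by apply: (can_inj (arc_endK D)); rewrite arc_end_next arc_toK.
Qed.

Lemma successor_matrixE n (D : gauss n) :
  successor_matrix D = perm_mx (next_arc D).
Proof.
apply/matrixP=> i j; rewrite !mxE -arc_end_next.
by rewrite (inj_eq (can_inj (arc_endK D))).
Qed.

Lemma sum_arcs (V : nmodType) n (D : gauss n) (F : 'I_n.*2 -> V) :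
  \sum_j F j = \sum_c (F (arc_to D (c, true)) + F (arc_to D (c, false))).
Proof.
rewrite (reindex (arc_to D)) /=; last first.
  by exists (arc_end D) => j _; rewrite ?arc_toK ?arc_endK.
rewrite (eq_bigr (fun p => F (arc_to D (p.1, p.2)))) => [|[] //].
rewrite -(pair_big xpredT xpredT (fun c b => F (arc_to D (c, b)))) /=.
by apply: eq_bigr => c _; rewrite big_bool.
Qed.

(** Indexed by over and under instead of by position, the blocks of positive and
    negative crossings have one common form in terms of the sign. *)
Lemma crossing_matrixE n (D : gauss n) c e c' e' :
  let s := crossing_sign D c in
  crossing_matrix D (arc_to D (c, e)) (arc_to D (c', e')) =
  if c == c' then
    match e, e' with
    | true, true => uvpow 0 (- s)
    | true, false => 0
    | false, true => 1 - uvpow (- s) (- s)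
    | false, false => uvpow (- s) 0
    end
  else 0.
Proof.
rewrite /= mxE.
have crossE d b : arc_crossing (arc_to D (d, b)) = d.
  by have := arc_toK D (d, b); rewrite /arc_end => - [].
rewrite !crossE; case: eqP => // <-{c'}.
have oddE b : odd (arc_to D (c, b)) = (b == positive D c).
  by rewrite /= oddD odd_double addFb oddb.
have bit (b : bool) : nat_of_ord (inord b : 'I_2) = b.
  by rewrite inordK; case: b.
rewrite !oddE /crossing_block /crossing_sign.
by case: (positive D c); rewrite mxE !bit; case: e; case: e';
   rewrite //= ?opprK.
Qed.

(** * The Alexander polynomial near u v = 1 *)

(** The quotient of [1 - (u v) ^ (- s)] by [1 - u v], for the sign [s = 1] if
    [b] and [s = -1] otherwise. *)
Definition one_sub_uvpow_quotient (b : bool) : laurent2 :=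
  if b then - uvpow (-1) (-1) else 1.

Lemma one_sub_uvpow_quotientE n (D : gauss n) c :
  let s := crossing_sign D c in
  1 - uvpow (- s) (- s) =
    (1 - uvpow 1 1) * one_sub_uvpow_quotient (positive D c).
Proof.
rewrite /one_sub_uvpow_quotient /crossing_sign; case: (positive D c).
  by rewrite mulrN mulrBl mul1r uvpowD opprB /= -gmono0.
by rewrite mulr1.
Qed.

(** An element of the kernel of the Alexander matrix at [u v = 1]. *)
Definition arc_weight n (D : gauss n) (p : 'I_n * bool) : laurent2 :=
  uvpow (- potential D p) 0.

Lemma arc_weight_next n (D : gauss n) p :
  arc_weight D (next (endpoints D) p) =
    uvpow (- endpoint_sign D p) 0 * arc_weight D p.
Proof. by rewrite /arc_weight potential_next uvpowD opprD addrC. Qed.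

(** The row of the Alexander matrix at [p], applied to the weights and divided
    by [1 - u v]; see [mul_alexander_matrix_weight]. *)
Definition weight_defect n (D : gauss n) (p : 'I_n * bool) : laurent2 :=
  (if p.2 then - uvpow (crossing_sign D p.1) 0 else 1) *
  (one_sub_uvpow_quotient (positive D p.1) * arc_weight D (p.1, true)).

(** At an under-crossing the term on the diagonal is the weight of the next
    arc, and the term [1 - (u v) ^ (- s)] remains.  At an over-crossing
    the remainder is [v ^ (- s) - u ^ s = - u ^ s (1 - (u v) ^ (- s))]. *)
Lemma mul_alexander_matrix_weight n (D : gauss n) :
  (crossing_matrix D - successor_matrix D) *m
    (\col_j arc_weight D (arc_end D j)) =
  (1 - uvpow 1 1) *: \col_j weight_defect D (arc_end D j).
Proof.
set x := \col_j _; have xE p : x (arc_to D p) 0 = arc_weight D p.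
  by rewrite mxE arc_toK.
have rowE c e : let s := crossing_sign D c in
    (crossing_matrix D *m x) (arc_to D (c, e)) 0 =
    if e then uvpow 0 (- s) * arc_weight D (c, true)
    else (1 - uvpow (- s) (- s)) * arc_weight D (c, true) +
      uvpow (- s) 0 * arc_weight D (c, false).
  rewrite /= mxE (sum_arcs D) (bigD1 c) //= big1 ?addr0; last first.
    move=> d dc; rewrite !crossing_matrixE eq_sym (negbTE dc).
    by rewrite !mul0r addr0.
  rewrite !xE !crossing_matrixE eqxx.
  by case: e; rewrite ?mul0r ?addr0.
apply/matrixP=> i j; rewrite {j}ord1.
transitivity ((crossing_matrix D *m x) i 0 - x (next_arc D i) 0).
  by rewrite mulmxBl successor_matrixE -row_permE !mxE.
have -> : x (next_arc D i) 0 = arc_weight D (next (endpoints D) (arc_end D i)).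
  by rewrite mxE arc_end_next.
rewrite -{1}(arc_endK D i) [RHS]mxE [X in _ = _ * X]mxE.
case: (arc_end D i) => c e; rewrite rowE arc_weight_next /weight_defect /=.
have := one_sub_uvpow_quotientE D c; have := uvpowD.
rewrite /endpoint_sign /=; case: e => /=; move: (crossing_sign D c) => s.
  move/(_ s 0 (- s) (- s)); rewrite add0r addrN opprK.
  move: (arc_weight _ _) (one_sub_uvpow_quotient _) (uvpow s 0) => X q U <-.
  move: (uvpow 1 1) (uvpow _ _) => w W Wq.
  have -> : (1 - w) * (- U * (q * X)) = - U * ((1 - w) * q) * X by ring.
  by rewrite -Wq; ring.
move=> _; move: (arc_weight _ _) (arc_weight _ _) => X Y.
move: (one_sub_uvpow_quotient _) (uvpow 1 1) => q w ->.
by move: (uvpow _ _) => U; ring.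
Qed.

Lemma tpowNK k : tpow (- k) * tpow k = 1.
Proof. by rewrite -tpowD addNr. Qed.

(** The two endpoints of each chord have opposite signs. *)
Lemma prod_tpow_endpoint_sign n (D : gauss n) :
  \prod_j tpow (- endpoint_sign D (arc_end D j)) = 1.
Proof.
rewrite -(big_morph tpow tpowD (erefl : tpow 0 = 1)) (sum_arcs D).
rewrite big1 //= => c _.
by rewrite !arc_toK /endpoint_sign /= opprK addrN.
Qed.

(** The off-diagonal entries [1 - (u v) ^ (- s)] of the crossing blocks vanish
    at [u v = 1]. *)
Lemma eval_alexander_matrix n (D : gauss n) :
  map_mx eval_t_tinv (crossing_matrix D - successor_matrix D) =
  diag_mx (\row_j tpow (- endpoint_sign D (arc_end D j))) -
    perm_mx (next_arc D).
Proof.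
rewrite map_mxB successor_matrixE; congr (_ - _); last first.
  by rewrite map_perm_mx.
apply/matrixP=> i j; rewrite mxE -(arc_endK D i) -(arc_endK D j).
case: (arc_end D i) (arc_end D j) => [c e] [c' e'].
rewrite crossing_matrixE !mxE (inj_eq (can_inj (arc_toK D))) arc_toK xpair_eqE.
rewrite /endpoint_sign; case: (c == c') => /=; last by rewrite raddf0.
case: e; case: e' => /=; rewrite ?raddf0 ?eval_uvpow ?sub0r ?subr0 //.
by rewrite rmorphB rmorph1 /= eval_uvpow subrr /tpow gmono0 subrr.
Qed.

(** From the arc leaving the under-crossing endpoint of [c] back to the arc
    entering the over-crossing one, the potential drops by the index of [c];
    this is where the index enters the Alexander polynomial. *)
Lemma eval_weight_defect n (D : gauss n) c e :
  eval_t_tinv (weight_defect D (c, e)) =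
  (if e then 1 else - tpow (chord_index D c)) *~ crossing_sign D c *
  eval_t_tinv (arc_weight D (next (endpoints D) (c, e))).
Proof.
have eval_quotient : eval_t_tinv (one_sub_uvpow_quotient (positive D c)) =
    (-1) *~ crossing_sign D c.
  rewrite /one_sub_uvpow_quotient /crossing_sign; case: (positive D c).
    by rewrite rmorphN /= eval_uvpow subrr.
  by rewrite rmorph1 mulrN1z opprK.
have over_case (R : comPzRingType) (X Y : R) s :
    - Y * (-1 *~ s * X) = 1 *~ s * (X * Y).
  by rewrite -[-1 *~ s]mulrzr; ring.
have under_case (R : comPzRingType) (X Y : R) s :
    -1 *~ s * (X * Y) = - X *~ s * Y.
  by rewrite -[-1 *~ s]mulrzr -[- X *~ s]mulrzr; ring.
rewrite /weight_defect /= !rmorphM /= eval_quotient /arc_weight potential_next.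
rewrite !eval_uvpow !subr0 /endpoint_sign /=; case: e.
  rewrite rmorphN /= eval_uvpow subr0 opprD opprK tpowD.
  exact: over_case.
have -> : - potential D (c, true) = chord_index D c +
    - (potential D (c, false) + crossing_sign D c).
  by rewrite chord_indexE; ring.
rewrite rmorph1 mul1r tpowD; exact: under_case.
Qed.

(** Cramer's rule. *)
Lemma det_of_mul_col (R : comPzRingType) n (A : 'M[R]_n) (x b : 'cV[R]_n)
    a j y :
  A *m x = a *: b -> y * x j 0 = 1 -> \det A = a * (y * (\adj A *m b) j 0).
Proof.
move/(congr1 (fun z : 'cV_n => (\adj A *m z) j 0)).
rewrite mulmxA mul_adj_mx mul_scalar_mx -scalemxAr mxE [RHS]mxE => detE yx.
by rewrite mulrCA -detE mulrCA yx mulr1.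
Qed.

(** Any arc may serve as [j0]: at [(t, t^-1)] its weight cancels against that
    of row [j0] of the adjugate. *)
Lemma diagram_alexander_writhe n (D : gauss n) :
  exists2 Delta', diagram_alexander D = (1 - uvpow 1 1) * Delta' &
    writhe_polynomial D = - eval_t_tinv Delta'.
Proof.
rewrite writhe_polynomial_sum.
case: n => [|n] in D *.
  by exists 0; rewrite ?mulr0 // raddf0 oppr0 big_ord0.
rewrite /diagram_alexander /=.
set A := crossing_matrix D - _; pose j0 : 'I_n.+1.*2 := ord0.
pose b := \col_j weight_defect D (arc_end D j).
exists (uvpow (potential D (arc_end D j0)) 0 * (\adj A *m b) j0 0).
  apply: (det_of_mul_col (mul_alexander_matrix_weight D)).
  by rewrite mxE uvpowD addrN.
rewrite rmorphM /= mxE rmorph_sum /= eval_uvpow subr0.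
pose X j := eval_t_tinv (arc_weight D (arc_end D j)).
have adjE j : eval_t_tinv (\adj A j0 j) * X (next_arc D j) = X j0.
  have -> : eval_t_tinv (\adj A j0 j) = (\adj (map_mx eval_t_tinv A)) j0 j.
    by rewrite -map_mx_adj [RHS]mxE.
  rewrite eval_alexander_matrix; apply: adj_diag_sub_cycle => //.
  - exact: next_arc_cyclic.
  - rewrite -[RHS](prod_tpow_endpoint_sign D).
    by apply: eq_bigr => k _; rewrite mxE.
  - move=> k; rewrite mxE /X arc_end_next /arc_weight potential_next.
    by rewrite !eval_uvpow !subr0 opprD -tpowD addrC.
pose beta (p : 'I_n.+1 * bool) : laurent1 :=
  (if p.2 then 1 else - tpow (chord_index D p.1)) *~ crossing_sign D p.1.
have shuffle (R : comPzRingType) (a d x y : R) :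
    a * x = y -> a * (d * x) = y * d by move=> <-; ring.
rewrite (eq_bigr (fun j => X j0 * beta (arc_end D j))); last first.
  move=> j _; rewrite rmorphM /= [b j 0]mxE; case jE: (arc_end D j) => [c e].
  rewrite eval_weight_defect -jE -arc_end_next jE.
  exact: shuffle (adjE j).
rewrite -mulr_sumr mulrA {1}/X /arc_weight eval_uvpow subr0 mulrC.
rewrite [tpow _ * _]mulrC tpowNK mulr1 (sum_arcs D) -sumrN.
apply: eq_bigr => c _; rewrite !arc_toK /beta /=.
by rewrite -mulrzDl -mulNrz opprD opprK addrC.
Qed.

(** * The theorem *)

Theorem theorem1 (K : virtual_knot) (W : laurent1) (Delta : laurent2)
  (hW : is_writhe_polynomial K W) (hDelta : is_alexander_polynomial K Delta) :
  (exists! Delta' : laurent2, Delta = (1 - uvpow 1 1) * Delta') /\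
  (forall Delta' : laurent2,
     Delta = (1 - uvpow 1 1) * Delta' -> W = - eval_t_tinv Delta').
Proof.
have [[n1 [D1 [KD1 ->]]] [n2 [D2 [KD2 ->]]]] := (hW, hDelta).
have [n [D KD]] := virtual_knotP K.
rewrite -(writhe_polynomial_equiv ((KD _ _).1 KD1)).
rewrite (writhe_polynomial_equiv ((KD _ _).1 KD2)).
have [Delta' alexE writheE] := diagram_alexander_writhe D2.
rewrite /alexander_polynomial /=; set k := - min_upow _.
have normE : uvpow k k * diagram_alexander D2 =
    (1 - uvpow 1 1) * (uvpow k k * Delta').
  by rewrite alexE; apply: mulrCA.
rewrite normE; split.
  exists (uvpow k k * Delta'); split=> [|f]; [exact: erefl | exact: mulI_1Buv].
move=> f /mulI_1Buv <-; rewrite writheE rmorphM /= eval_uvpow subrr.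
by rewrite /tpow gmono0 mul1r.
Qed.
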